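(* Let $k\ge1$, let $v_1,\dots,v_{k+1}\in\mathcal{H}$, and put $\mathcal{V}_k=\operatorname{span}\{v_i\}_{i=1}^k$, $\mathcal{V}_{k+1}=\operatorname{span}\{v_i\}_{i=1}^{k+1}$. Assume $\mathcal{V}_{k+1}\cap\mathcal{W}^\perp=\{0\}$ and $v_{k+1}\notin\mathcal{V}_k$. Let $u_i=v_i-\hat P_{\mathcal{W}^\perp}v_i$ for $i=1,\dots,k+1$ and $\mathcal{W}_k=\operatorname{span}\{u_i\}_{i=1}^k$. Let $\tilde u_1^k,\dots,\tilde u_k^k\in\mathcal{H}$ be vectors such that $\hat E_{\mathcal{V}_k\mathcal{W}^\perp}=\sum_{i=1}^k v_i\langle\tilde u_i^k,\cdot\rangle$. Define $$q_{k+1}=u_{k+1}-\hat P_{\mathcal{W}_k}u_{k+1},\qquad \tilde u_{k+1}^{k+1}=\frac{q_{k+1}}{\|q_{k+1}\|^2},\qquad \tilde u_i^{k+1}=\tilde u_i^k-\tilde u_{k+1}^{k+1}\langle u_{k+1},\tilde u_i^k\rangle,\quad i=1,\dots,k.$$ Then these vectors provide the oblique projector onto $\mathcal{V}_{k+1}$ along $\mathcal{W}^\perp$: $$\hat E_{\mathcal{V}_{k+1}\mathcal{W}^\perp}=\sum_{i=1}^{k+1}v_i\langle\tilde u_i^{k+1},\cdot\rangle.$$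
   Context: $\mathcal{H}$ is a complex inner product space; $\langle\cdot,\cdot\rangle$ is conjugate-linear in the first argument and linear in the second, and $v\langle u,\cdot\rangle$ denotes the operator $f\mapsto\langle u,f\rangle v$. $\hat P_{\mathcal{X}}$ denotes the orthogonal projector of $\mathcal{H}$ onto a subspace $\mathcal{X}$. $\mathcal{W}^\perp\subset\mathcal{H}$ is a fixed closed subspace (the symbol is just its name) for which $\hat P_{\mathcal{W}^\perp}$ exists. For a finite-dimensional subspace $\mathcal{X}\subset\mathcal{H}$ with $\mathcal{X}\cap\mathcal{W}^\perp=\{0\}$, the oblique projector $\hat E_{\mathcal{X}\mathcal{W}^\perp}$ onto $\mathcal{X}$ along $\mathcal{W}^\perp$ is the linear operator on $\mathcal{H}$ with $\hat E_{\mathcal{X}\mathcal{W}^\perp}x=x$ for $x\in\mathcal{X}$, $\hat E_{\mathcal{X}\mathcal{W}^\perp}w=0$ for $w\in\mathcal{W}^\perp$, and $\hat E_{\mathcal{X}\mathcal{W}^\perp}f=0$ for $f$ orthogonal to $\mathcal{X}+\mathcal{W}^\perp$. (If $\mathcal{X}=\operatorname{span}\{v_i\}_{i=1}^k$ and $\hat V:\mathbb{C}^k\to\mathcal{H}$ sends the $i$-th standard basis vector to $v_i$, this is $\hat V(\hat V^*\hat P\hat V)^\dagger\hat V^*\hat P$, where $\hat P$ is the orthogonal projector onto the orthogonal complement of $\mathcal{W}^\perp$ in $\mathcal{X}+\mathcal{W}^\perp$ and $\dagger$ is the Moore-Penrose pseudo-inverse.) The space $\mathcal{W}_k$ equals the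 orthogonal complement of $\mathcal{W}^\perp$ in $\mathcal{V}_k+\mathcal{W}^\perp$. *)

(* Defs.v *)
From HB Require Import structures.
From mathcomp Require Export all_boot all_order all_algebra.
From mathcomp Require Export boolp classical_sets reals.
From mathcomp Require Export complex.

Set Implicit Arguments.
Unset Strict Implicit.
Unset Printing Implicit Defensive.

Import Order.TTheory GRing.Theory Num.Theory.

Local Open Scope classical_set_scope.
Local Open Scope ring_scope.

(* A complex inner product space is an lmodType H over R[i], of arbitrary
   dimension and not necessarily complete, with a positive definite form
   dot : {dot H for Num.conj}. *)
Section InnerProductSpace.
Context {R : realType} {H : lmodType R[i]}.
Implicit Types (X W : set H) (P E : H -> H).

(* Forms of type {dot H for _} are linear in their FIRST argument; the
   arguments are swapped so that <u, f> is conjugate-linear in u. *)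
Definition inner (dot : {dot H for Num.conj}) (u f : H) : R[i] := dot f u.

Context (dot : {dot H for Num.conj}).
Local Notation "<< u , f >>" := (inner dot u f).

Definition hnorm (u : H) : R[i] := sqrtC << u, u >>.

Definition is_subspace X :=
  X 0 /\ forall (a : R[i]) x y, X x -> X y -> X (a *: x + y).

(* In R[i], 0 < e means that e is a positive real. *)
Definition norm_closed X :=
  forall f : H, (forall e : R[i], 0 < e -> exists2 x, X x & hnorm (f - x) < e) ->
    X f.

Definition lspan (n : nat) (v : 'I_n -> H) : set H :=
  [set x | exists c : 'I_n -> R[i], x = \sum_(i < n) c i *: v i].

Definition sumset X W : set H := [set x + w | x in X & w in W].

Definition orthogonal_to X : set H := [set f | forall x, X x -> << x, f >> = 0].

Definition is_orth_projector X P :=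
  linear P /\ forall f, X (P f) /\ orthogonal_to X (f - P f).

(* Only meaningful when the projector exists; it is then unique
   (orth_projector_unique). *)
Definition orth_projector X : H -> H :=
  xget (fun=> 0) [set P | is_orth_projector X P].

Definition is_oblique_projector X W E :=
  [/\ linear E,
      forall x, X x -> E x = x,
      forall w, W w -> E w = 0 &
      forall f, orthogonal_to (sumset X W) f -> E f = 0].

(* Only meaningful when X is finite-dimensional, X and W meet in {0} and the
   orthogonal projector onto W exists, in which case it exists and is unique
   (oblique_projectorP, oblique_projector_unique). *)
Definition oblique_projector X W : H -> H :=
  xget (fun=> 0) [set E | is_oblique_projector X W E].

Lemma innerDr u f g : << u, f + g >> = << u, f >> + << u, g >>.
Proof. by rewrite /inner linearDl. Qed.

Lemma innerBr u f g : << u, f - g >> = << u, f >> - << u, g >>.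
Proof. by rewrite /inner linearBl. Qed.

Lemma innerZr u a f : << u, a *: f >> = a * << u, f >>.
Proof. by rewrite /inner linearZl_LR. Qed.

Lemma inner_conj u f : << f, u >> = (<< u, f >>)^*.
Proof. by rewrite /inner hermC expr0 mul1r. Qed.

Lemma inner_eq0 u : << u, u >> = 0 -> u = 0.
Proof. by move/eqP; rewrite /inner dnorm_eq0 => /eqP. Qed.

Lemma is_subspaceB X x y : is_subspace X -> X x -> X y -> X (x - y).
Proof. by move=> [_ Xl] Xx Xy; rewrite addrC -scaleN1r; apply: Xl. Qed.

Lemma orthogonal_to_subspace X : is_subspace (orthogonal_to X).
Proof.
split=> [x Xx|a f g fX gX x Xx]; first by rewrite -(scale0r 0) innerZr mul0r.
by rewrite innerDr innerZr fX // gX // mulr0 addr0.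
Qed.

Lemma orthogonal_to0 X x : X x -> orthogonal_to X x -> x = 0.
Proof. by move=> Xx /(_ x Xx) /inner_eq0. Qed.

Lemma lspan_subspace n (v : 'I_n -> H) : is_subspace (lspan v).
Proof.
split=> [|a _ _ [c ->] [d ->]].
  by exists (fun=> 0); rewrite big1 // => i _; rewrite scale0r.
exists (fun i => a * c i + d i); rewrite scaler_sumr -big_split /=.
by apply: eq_bigr => i _; rewrite scalerDl scalerA.
Qed.

Lemma orth_decomp_unique X f x y : is_subspace X ->
  X x -> orthogonal_to X (f - x) -> X y -> orthogonal_to X (f - y) -> x = y.
Proof.
move=> sX Xx fx Xy fy; apply/subr0_eq/(@orthogonal_to0 X).
  exact: is_subspaceB.
have -> : x - y = (f - y) - (f - x) by rewrite opprB [RHS]addrC subrKA.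
exact: is_subspaceB (orthogonal_to_subspace X) fy fx.
Qed.

Lemma orth_projector_unique X P P' : is_subspace X ->
  is_orth_projector X P -> is_orth_projector X P' -> P = P'.
Proof.
move=> sX [_ hP] [_ hP']; apply: funext => f.
have [XP oP] := hP f; have [XP' oP'] := hP' f.
exact: (orth_decomp_unique sX XP oP XP' oP').
Qed.

Lemma orth_projectorP X : (exists P, is_orth_projector X P) ->
  is_orth_projector X (orth_projector X).
Proof. exact: (@xgetPex _ (fun=> 0) [set P | is_orth_projector X P]). Qed.

Lemma lspan_orth_projector n (v : 'I_n -> H) :
  exists P, is_orth_projector (lspan v) P.
Proof.
suff dec f : exists x, lspan v x /\ orthogonal_to (lspan v) (f - x).
  have [P hP] := choice dec; exists P; split=> // a f g.
  have [XPf oPf] := hP f; have [XPg oPg] := hP g; have [XP oP] := hP (a *: f + g).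
  have sX := lspan_subspace v.
  apply: (orth_decomp_unique sX XP oP); first exact: sX.2.
  rewrite opprD addrACA -scalerBr.
  exact: (orthogonal_to_subspace _).2.
elim: n v f => [|n IH] v f.
  exists 0; split; first exact: (lspan_subspace v).1.
  by move=> _ [c ->]; rewrite big_ord0 inner_conj -(scale0r 0) innerZr mul0r rmorph0.
pose w i := v (widen_ord (leqnSn n) i); pose y := v ord_max.
have wv x a : lspan w x -> lspan v (x + a *: y).
  move=> [c ->]; exists (fun i => if unlift ord_max i is Some j then c j else a).
  rewrite big_ord_recr /= unlift_none; congr (_ + _).
  apply: eq_bigr => i _; have -> : widen_ord (leqnSn n) i = lift ord_max i.
    by apply: val_inj; rewrite /= /bump leqNgt ltn_ord.
  rewrite liftK; congr (_ *: v _).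
  by apply: val_inj; rewrite /= /bump leqNgt ltn_ord.
have [y' [wy' oy']] := IH w y; have [f' [wf' of']] := IH w f.
pose q := y - y'; pose a := << q, f >> / << q, q >>.
have wq x : lspan w x -> << x, q >> = 0 by move/oy'.
exists (f' + a *: q); split.
  rewrite scalerBr addrCA addrC; apply: wv.
  rewrite addrC -scaleNr; apply: (lspan_subspace w).2 => //.
move=> _ [c ->]; rewrite big_ord_recr /= -/y.
have -> : y = y' + q by rewrite addrC subrK.
rewrite scalerDr addrA; set x := _ + _ *: y'.
have wx : lspan w x.
  rewrite /x addrC; apply: (lspan_subspace w).2 => //.
  by exists (fun i => c (widen_ord (leqnSn n) i)).
have xo : << x, f - (f' + a *: q) >> = 0.
  by rewrite opprD addrA innerBr of' // innerZr wq // mulr0 subr0.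
have qo : << q, f - (f' + a *: q) >> = 0.
  rewrite opprD addrA !innerBr innerZr (inner_conj f' q) wq // rmorph0 subr0.
  have [q0|/eqP qN0] := pselect (<< q, q >> = 0); last by rewrite divfK // subrr.
  by rewrite q0 mulr0 (inner_eq0 q0) /inner linear0r subr0.
rewrite inner_conj innerDr innerZr (inner_conj x) (inner_conj q) xo qo.
by rewrite rmorph0 mulr0 addr0 rmorph0.
Qed.

Section ObliqueProjector.
Variables (n : nat) (v : 'I_n -> H) (W : set H).
Hypothesis sW : is_subspace W.
Hypothesis projW : exists P, is_orth_projector W P.
Hypothesis vW : lspan v `&` W = [set 0].

Let X := lspan v.
Let Q f := f - orth_projector W f.
Let U := lspan (Q \o v).

Let Ql : linear Q.
Proof.
have [Pl _] := orth_projectorP projW.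
by move=> a f g; rewrite /Q Pl opprD addrACA -scalerBr.
Qed.

Let PW f : W (orth_projector W f) /\ orthogonal_to W (Q f).
Proof. exact: (orth_projectorP projW).2. Qed.

Let Q_lspan c : Q (\sum_(i < n) c i *: v i) = \sum_(i < n) c i *: Q (v i).
Proof.
have Q0 : Q 0 = 0.
  by have := Ql (-1) 0 0; rewrite scaler0 addr0 scaleN1r addNr.
elim/big_rec2: _ => [|i y1 y2 _ <-]; [exact: Q0 | exact: Ql].
Qed.

Let QX x : X x -> U (Q x).
Proof. by move=> [c ->]; exists c; rewrite Q_lspan. Qed.

Let XQ u : U u -> exists2 x, X x & u = Q x.
Proof. by move=> [c ->]; exists (\sum_(i < n) c i *: v i); [exists c | rewrite Q_lspan]. Qed.

Let Qinj x y : X x -> X y -> Q x = Q y -> x = y.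
Proof.
move=> Xx Xy Qxy; apply: subr0_eq.
have : (X `&` W) (x - y).
  split; first exact: is_subspaceB (lspan_subspace v) _ _.
  have -> : x - y = orth_projector W x - orth_projector W y.
    rewrite -{1}(subrK (orth_projector W x) x) -{1}(subrK (orth_projector W y) y).
    by rewrite -/(Q x) -/(Q y) Qxy opprD addrACA subrr add0r.
  exact: is_subspaceB sW (PW x).1 (PW y).1.
by rewrite vW.
Qed.

Let UW u w : U u -> W w -> << w, u >> = 0.
Proof. by move=> /XQ[x _ ->] /(PW x).2. Qed.

Let PU := lspan_orth_projector (Q \o v).

Let decomp f : exists2 x, X x & orthogonal_to (sumset X W) (Q f - Q x).
Proof.
have [P [_ hP]] := PU; have [UPf oPf] := hP (Q f).
have [x Xx eqx] := XQ UPf; exists x => //.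
have oW w : W w -> << w, Q f - Q x >> = 0.
  by move=> Ww; rewrite innerBr !(PW _).2 // subrr.
move=> _ [y Xy [w Ww <-]].
have -> : y + w = Q y + (orth_projector W y + w) by rewrite addrA subrK.
have oy : << Q y, Q f - Q x >> = 0 by rewrite -eqx; apply: oPf; apply: QX.
rewrite inner_conj innerDr (inner_conj (Q y)) oy rmorph0 add0r.
rewrite (inner_conj (_ + w)) oW ?rmorph0 //.
by rewrite -[orth_projector W y]scale1r; apply: sW.2 => //; apply: (PW y).1.
Qed.

Lemma oblique_projector_unique E E' :
  is_oblique_projector X W E -> is_oblique_projector X W E' -> E = E'.
Proof.
suff val E0 f x : X x -> orthogonal_to (sumset X W) (Q f - Q x) ->
    is_oblique_projector X W E0 -> E0 f = x.
  move=> hE hE'; apply: funext => f; have [x Xx ox] := decomp f.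
  by rewrite (val E f x) // (val E' f x).
move=> Xx ox [El EX EW Eo].
have ED g h : E0 (g + h) = E0 g + E0 h by rewrite -[g]scale1r El !scale1r.
have EB g h : E0 (g - h) = E0 g - E0 h.
  by rewrite addrC -scaleN1r El scaleN1r addrC.
have EQ g : E0 (Q g) = E0 g by rewrite EB (EW _ (PW g).1) subr0.
by have := Eo _ ox; rewrite EB !EQ (EX x) // => /subr0_eq.
Qed.

Lemma oblique_projectorP :
  is_oblique_projector X W (oblique_projector X W).
Proof.
apply: (@xgetPex _ (fun=> 0) [set E | is_oblique_projector X W E]).
have [P hP] := PU.
have dec f : exists x, X x /\ P (Q f) = Q x.
  by have [x Xx ->] := XQ (hP.2 (Q f)).1; exists x.
have [E hE] := choice dec; exists E.
have sU : is_subspace U := lspan_subspace _.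
have PE u x : U x -> orthogonal_to U (u - x) -> P u = x.
  by have [UP oP] := hP.2 u; move=> Ux ox; apply: orth_decomp_unique ox.
split=> [a f g|x Xx|w Ww|f fo].
- apply: Qinj; first exact: (hE _).1.
    by apply: (lspan_subspace v).2; apply: (hE _).1.
  by rewrite Ql -!(hE _).2 Ql hP.1.
- apply: Qinj => //; first exact: (hE _).1.
  rewrite -(hE x).2; apply: PE; first exact: QX.
  by rewrite subrr; apply: (orthogonal_to_subspace U).1.
- apply: Qinj; [exact: (hE _).1 | exact: (lspan_subspace v).1 |].
  have Q0 : Q 0 = 0.
    by have := Ql (-1) 0 0; rewrite scaler0 addr0 scaleN1r addNr.
  rewrite -(hE w).2 Q0; apply: PE; first exact: sU.1.
  suff -> : Q w = 0 by rewrite subrr; apply: (orthogonal_to_subspace U).1.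
  apply: (@orthogonal_to0 W); last exact: (PW w).2.
  exact: is_subspaceB sW Ww (PW w).1.
apply: Qinj; [exact: (hE _).1 | exact: (lspan_subspace v).1 |].
have Q0 : Q 0 = 0.
  by have := Ql (-1) 0 0; rewrite scaler0 addr0 scaleN1r addNr.
rewrite -(hE f).2 Q0; apply: PE; first exact: sU.1.
move=> u Uu; rewrite subr0 innerBr [X in _ - X]inner_conj (UW Uu (PW f).1).
rewrite rmorph0 subr0; have [x Xx ->] := XQ Uu; apply: fo.
exists x => //; exists (- orth_projector W x) => //.
have := is_subspaceB sW sW.1 (PW x).1; by rewrite sub0r.
Qed.

End ObliqueProjector.

End InnerProductSpace.

(* Main.v *)
(* With E the oblique projector onto V_k and y = v_{k+1}, the proposed sum is
   f |-> E f + (<q, f> / ||q||^2) (y - E y), because E y = E u_{k+1}; it depends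
   on the vectors ut_i only through E, so they need not be unique.  Since
   q is orthogonal to V_k and to W, belongs to V_{k+1} + W and satisfies
   <q, y> = ||q||^2, this map is the oblique projector onto V_{k+1}. *)
Require Import Defs.

Import Order.TTheory GRing.Theory Num.Theory.
Local Open Scope classical_set_scope.
Local Open Scope ring_scope.

Section InnerProduct.
Set Implicit Arguments.
Unset Strict Implicit.

Context {R : realType} {H : lmodType R[i]} (dot : {dot H for Num.conj}).
Implicit Types (X W : set H) (E : H -> H).
Local Notation "<< u , f >>" := (inner dot u f).

Lemma innerBl u w f : << u - w, f >> = << u, f >> - << w, f >>.
Proof. by rewrite /inner linearBr. Qed.

Lemma innerZl a u f : << a *: u, f >> = Num.conj a * << u, f >>.
Proof. by rewrite /inner linearZr_LR. Qed.

Lemma inner_lincombr u n (c : 'I_n -> R[i]) (w : 'I_n -> H) :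
  << u, \sum_(i < n) c i *: w i >> = \sum_(i < n) c i * << u, w i >>.
Proof.
by rewrite /inner linear_sumlz; apply: eq_bigr => i _; rewrite linearZl_LR.
Qed.

Lemma orthogonal_toC X f x : orthogonal_to dot X f -> X x -> << f, x >> = 0.
Proof. by move=> oX Xx; rewrite inner_conj oX // rmorph0. Qed.

Lemma hnorm_sqr u : hnorm dot u ^+ 2 = << u, u >>.
Proof. exact: sqrtCK. Qed.

Lemma lspan_recrP n (v : 'I_n.+1 -> H) x :
  lspan v x <-> exists2 y, lspan (fun i : 'I_n => v (widen_ord (leqnSn n) i)) y &
    exists a, x = y + a *: v ord_max.
Proof.
split=> [[c ->]|[_ [c ->] [a ->]]].
  rewrite big_ord_recr /=; eexists; last by exists (c ord_max).
  by exists (fun i => c (widen_ord (leqnSn n) i)).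
exists (fun i => if unlift ord_max i is Some j then c j else a).
rewrite big_ord_recr /= unlift_none; congr (_ + _); apply: eq_bigr => i _.
have -> : widen_ord (leqnSn n) i = lift ord_max i.
  by apply: ord_inj; rewrite lift_max.
by rewrite liftK.
Qed.

(** If [x = z + a *: y] with [z] in [X], then [<< q, x >> = a * << q, q >>], so the correction turns
    [E x = z + a *: E y] into [x]. It vanishes on [W] because [q] is orthogonal to [W], and on
    vectors orthogonal to [X' + W] because [q] lies in [X' + W]. *)
Lemma oblique_projector_extend X X' W E y q :
    (forall x, X' x <-> exists2 z, X z & exists a, x = z + a *: y) ->
    is_oblique_projector dot X W E ->
    orthogonal_to dot X q -> orthogonal_to dot W q -> sumset X' W q ->
    << q, y >> = << q, q >> -> q <> 0 ->
  is_oblique_projector dot X' W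
    (fun f => E f + (<< q, f >> / << q, q >>) *: (y - E y)).
Proof.
move=> X'P [El EX EW Eo] qX qW X'Wq qy /eqP q0.
have qq0 : << q, q >> != 0 by apply: contra_neq q0 => /inner_eq0.
split=> [a f g|_ /X'P[z Xz [a ->]]|w Ww|f fo].
- rewrite El innerDr innerZr mulrDl scalerDl [a *: (_ + _)]scalerDr scalerA -mulrA.
  by rewrite addrACA.
- rewrite addrC innerDr innerZr qy (orthogonal_toC qX Xz) add0r mulfK //.
  by rewrite [z + _]addrC El (EX z) // scalerBr addrA subrK addrC.
- by rewrite EW // (orthogonal_toC qW Ww) mul0r scale0r addr0.
rewrite Eo ?fo ?mul0r ?scale0r ?addr0 // => _ [x Xx [w Ww <-]].
apply: fo; exists x; last by exists w.
by apply/X'P; exists x => //; exists 0; rewrite scale0r addr0.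
Qed.

End InnerProduct.

Theorem proposition2 (R : realType) (H : lmodType R[i])
    (dot : {dot H for Num.conj}) (W : set H)
    (W_subspace : is_subspace W) (W_closed : norm_closed dot W)
    (PW_exists : exists P : H -> H, is_orth_projector dot W P)
    (k : nat) (k_ge1 : (1 <= k)%N) (v : 'I_k.+1 -> H) :
  let old (i : 'I_k) : 'I_k.+1 := widen_ord (leqnSn k) i in
  let new : 'I_k.+1 := ord_max in
  let Vk := lspan (fun i : 'I_k => v (old i)) in
  let Vk1 := lspan v in
  Vk1 `&` W = [set 0] ->
  ~ Vk (v new) ->
  let u (i : 'I_k.+1) := v i - orth_projector dot W (v i) in
  let Wk := lspan (fun i : 'I_k => u (old i)) in
  forall ut : 'I_k -> H,
  oblique_projector dot Vk W =
    (fun f => \sum_(i < k) inner dot (ut i) f *: v (old i)) ->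
  let q := u new - orth_projector dot Wk (u new) in
  forall ut1 : 'I_k.+1 -> H,
  ut1 new = (hnorm dot q ^+ 2)^-1 *: q ->
  (forall i : 'I_k,
    ut1 (old i) = ut i - inner dot (u new) (ut i) *: ut1 new) ->
  oblique_projector dot Vk1 W =
    (fun f => \sum_(i < k.+1) inner dot (ut1 i) f *: v i).
Proof.
move=> old new Vk Vk1 VW vnew u Wk ut Eut q ut1 ut1new ut1old.
have VkVk1 x a : Vk x -> Vk1 (x + a *: v new).
  by move=> Vx; apply/lspan_recrP; exists x => //; exists a.
(* A trivial intersection for [Vk] ensures that [E] below is a genuine oblique projector, not the
   default value of [xget]. *)
have VkW : Vk `&` W = [set 0].
  apply/seteqP; split=> [x [Vx Wx]|_ ->].
    by rewrite -VW; split=> //; rewrite -[x]addr0 -(scale0r (v new)); apply: VkVk1.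
  by split; [apply: (lspan_subspace _).1 | apply: W_subspace.1].
set E := oblique_projector dot Vk W in Eut.
have EP : is_oblique_projector dot Vk W E by apply: oblique_projectorP.
have [El _ EW _] := EP.
have [_ PWP] := orth_projectorP PW_exists.
have PkP f :
    Wk (orth_projector dot Wk f) /\ orthogonal_to dot Wk (f - orth_projector dot Wk f).
  exact: (orth_projectorP (lspan_orth_projector _ _)).2.
have sW := W_subspace.
(* Each [u i] differs from [v i] by an element of [W], so [Wk] and [Vk] agree modulo [W]. *)
have WkP y : Wk y -> exists2 x, Vk x & W (x - y).
  move=> [c ->]; exists (\sum_(i < k) c i *: v (old i)); first by exists c.
  rewrite -sumrB; apply: (big_ind W); first exact: sW.1.
    by move=> x z Wx Wz; rewrite -[x]scale1r; apply: sW.2.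
  move=> i _; rewrite -scalerBr subKr -[_ *: _]addr0.
  by apply: sW.2; [apply: (PWP _).1 | apply: sW.1].
have [x Vx Wx] := WkP _ (PkP (u new)).1.
have Vvx : Vk1 (v new - x).
  rewrite -[v new]scale1r addrC; apply: VkVk1.
  by rewrite -sub0r; apply: is_subspaceB (lspan_subspace _) (lspan_subspace _).1 Vx.
(* Modulo [W], [u new] is [v new] and its projection onto [Wk] is [x]; hence [q] is [v new - x] up
   to some [w]. *)
have [w Ww qE] : exists2 w, W w & v new - x + w = q.
  exists (x - orth_projector dot Wk (u new) - orth_projector dot W (v new)).
    by apply: is_subspaceB => //; apply: (PWP _).1.
  by rewrite /q /u addrA addrA subrK addrAC.
(* [q] is a combination of the vectors [u i], all orthogonal to [W]. *)
have qW : orthogonal_to dot W q.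
  apply: is_subspaceB (orthogonal_to_subspace dot W) (PWP _).2 _.
  have [c ->] := (PkP (u new)).1.
  move=> z Wz; rewrite inner_lincombr big1 // => i _.
  by rewrite (PWP _).2 // mulr0.
have qWk : orthogonal_to dot Wk q := (PkP (u new)).2.
(* [q] does not see the component of [v i] in [W], so its orthogonality to [Wk] carries over to
   [Vk]. *)
have qu i : inner dot q (v i) = inner dot q (u i).
  by rewrite /u innerBr (orthogonal_toC qW (PWP _).1) subr0.
have qV : orthogonal_to dot Vk q.
  move=> _ [c ->]; rewrite inner_conj -[RHS](rmorph0 Num.conj); congr (_^*).
  have Wkc : Wk (\sum_(i < k) c i *: u (old i)) by exists c.
  rewrite -[RHS](orthogonal_toC qWk Wkc) !inner_lincombr.
  by apply: eq_bigr => i _; rewrite qu.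
have qv : inner dot q (v new) = inner dot q q.
  rewrite qu -[u new in LHS](subrK (orth_projector dot Wk (u new))) innerDr.
  by rewrite (orthogonal_toC qWk (PkP _).1) addr0.
(* [q = 0] would put [v new - x] in both [Vk1] and [W], forcing [v new = x], a member of [Vk]. *)
have q0 : q <> 0.
  move=> q0; apply: vnew; suff /subr0_eq -> : v new - x = 0 by [].
  suff : (Vk1 `&` W) (v new - x) by rewrite VW.
  split=> //; rewrite -[_ - x]opprK (addr0_eq (etrans qE q0)) -sub0r.
  exact: is_subspaceB sW.1 Ww.
have Vk1Wq : sumset Vk1 W q by exists (v new - x) => //; exists w.
have Eext := oblique_projector_extend (lspan_recrP v) EP qV qW Vk1Wq qv q0.
rewrite (oblique_projector_unique sW PW_exists
  (oblique_projectorP sW PW_exists VW) Eext).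
(* This lets [Eut] expand [E (v new)] with coefficients [<< ut i, u new >>], the conjugates of the
   scalars in [ut1old]. *)
have Eu : E (u new) = E (v new).
  by rewrite /u addrC -scaleN1r El (EW _ (PWP _).1) scaler0 add0r.
apply: funext => f; rewrite big_ord_recr /= -/new.
(* The scalar leaves the first argument conjugated, but [<< q, q >>] is its own conjugate. *)
have tE : inner dot (ut1 new) f = inner dot q f / inner dot q q.
  by rewrite ut1new hnorm_sqr innerZl fmorphV mulrC; congr (_ * _^-1); rewrite [RHS]inner_conj.
rewrite tE scalerBr addrCA addrC -Eu Eut scaler_sumr -sumrB.
congr (_ + _); apply: eq_bigr => i _.
rewrite ut1old [inner dot (ut i - _) f]innerBl [inner dot (_ *: ut1 new) f]innerZl.
by rewrite -inner_conj tE scalerBl scalerA [in RHS]mulrC.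
Qed.
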